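(* Let $\widehat{\mathbf E}_{i_k}\in\mathbb C^{d\times d}$ be the (Hermitian positive definite) MMSE matrix of user $i_k$ evaluated at a feasible precoder $\widehat{\mathbf V}$, and let $\mathbf H^k_{i_k}\in\mathbb C^{N\times MQ_k}$ be the channel matrix. Then the function $$l_{i_k}(\mathbf V_{i_k},\mathbf C_{i_k}):=\mathrm{Tr}\left[\widehat{\mathbf E}_{i_k}^{-1}\mathbf V_{i_k}^H(\mathbf H^k_{i_k})^H\mathbf C_{i_k}^{-1}\mathbf H^k_{i_k}\mathbf V_{i_k}\right]$$ is jointly convex with respect to the pair of variables $(\mathbf V_{i_k},\mathbf C_{i_k})$ on the region $\mathbb C^{MQ_k\times d}\times\mathbb S^N_{++}$.
   Context: $\mathbb S^N_{++}$ is the set of $N\times N$ Hermitian positive definite complex matrices, $(\cdot)^H$ is conjugate transpose; convexity is in the sense of real vector spaces (the function is real-valued). $M,N,Q_k,d$ are positive integers with $d\le\min\{M,N\}$. Multi-cell network: $\mathcal K=\{1,\dots,K\}$ is a finite set of cells, $\mathcal I_\ell$ the finite set of users of cell $\ell$, $Q_\ell$ the number of base stations ($M$ antennas each) in cell $\ell$, $\mathbf H^\ell_{i_k}\in\mathbb C^{N\times MQ_\ell}$ the fixed channel matrix from cell $\ell$ to user $i_k$ (the $i$-th user of cell $k$), and $\sigma^2>0$ the noise power. For a precoder collection $\widehat{\mathbf V}=\{\widehat{\mathbf V}_{j_\ell}\}$ with $\widehat{\mathbf V}_{j_\ell}\in\mathbb C^{MQ_\ell\times d}$, the MMSE matrix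 is $$\widehat{\mathbf E}_{i_k}=\mathbf I_d-\widehat{\mathbf V}_{i_k}^H(\mathbf H^k_{i_k})^H\Big(\sum_{\ell\in\mathcal K}\sum_{j_\ell\in\mathcal I_\ell}\mathbf H^\ell_{i_k}\widehat{\mathbf V}_{j_\ell}\widehat{\mathbf V}_{j_\ell}^H(\mathbf H^\ell_{i_k})^H+\sigma^2\mathbf I_N\Big)^{-1}\mathbf H^k_{i_k}\widehat{\mathbf V}_{i_k},$$ which is Hermitian positive definite. In $l_{i_k}$, $\widehat{\mathbf E}_{i_k}$ and $\mathbf H^k_{i_k}$ are fixed, and $\mathbf V_{i_k}$, $\mathbf C_{i_k}$ are treated as independent variables. *)

(* Defs.v *)
From HB Require Import structures.
From mathcomp Require Import all_boot all_order all_algebra.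
From mathcomp Require Import sesquilinear spectral complex.
From mathcomp Require Import boolp classical_sets reals convex.

Set Implicit Arguments.
Unset Strict Implicit.
Unset Printing Implicit Defensive.

Import Order.TTheory GRing.Theory Num.Theory.
Local Open Scope ring_scope.
Local Open Scope complex_scope.
Local Open Scope sesquilinear_scope.

(* Restriction of scalars along R -> R[i]: [realified V] is the complex vector
   space V regarded as a real one, as needed by [convex_set] and
   [convex_function]. *)
Definition realified (R : rcfType) (V : lmodType R[i]) : Type := V.

Section Realified.
Variables (R : rcfType) (V : lmodType R[i]).

HB.instance Definition _ := GRing.Zmodule.on (realified V).

Definition realified_scale (a : R) (v : realified V) : realified V :=
  a%:C *: (v : V).

Fact realified_scaleA a b v :
  realified_scale a (realified_scale b v) = realified_scale (a * b) v.
Proof. by rewrite /realified_scale scalerA -rmorphM. Qed.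

Fact realified_scale1 : left_id 1 realified_scale.
Proof. by move=> v; rewrite /realified_scale rmorph1 scale1r. Qed.

Fact realified_scaleDr : right_distributive realified_scale +%R.
Proof. by move=> a u v; rewrite /realified_scale scalerDr. Qed.

Fact realified_scaleDl v : {morph realified_scale^~ v : a b / a + b}.
Proof. by move=> a b; rewrite /realified_scale rmorphD scalerDl. Qed.

HB.instance Definition _ := GRing.Zmodule_isLmodule.Build R (realified V)
  realified_scaleA realified_scale1 realified_scaleDr realified_scaleDl.

End Realified.

(* The strict inequality is that of R[i], so it also asserts that the
   quadratic form is real. *)
Definition hermposdef (R : rcfType) (n : nat) (A : 'M[R[i]]_n) : Prop :=
  A \is hermsymmx /\
  forall x : 'cV[R[i]]_n, x != 0 -> 0 < (x^t* *m A *m x) 0 0.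

Section Network.
Variables (R : rcfType) (K M N d : nat).
Variables (Q : 'I_K -> nat) (I : 'I_K -> finType).
(* [H l k i] is the channel from cell l to user i of cell k. *)
Variable H : forall l k : 'I_K, I k -> 'M[R[i]]_(N, M * Q l).
Variable sigma : R.

(* Received-signal covariance at user i of cell k. *)
Definition rx_cov (V : forall l : 'I_K, I l -> 'M[R[i]]_(M * Q l, d))
    (k : 'I_K) (i : I k) : 'M[R[i]]_N :=
  \sum_(l : 'I_K) \sum_(j : I l)
     H l i *m V l j *m (V l j)^t* *m (H l i)^t*
  + (sigma ^+ 2)%:C%:M.

Definition mmse (V : forall l : 'I_K, I l -> 'M[R[i]]_(M * Q l, d))
    (k : 'I_K) (i : I k) : 'M[R[i]]_d :=
  1%:M - (V k i)^t* *m (H k i)^t* *m invmx (rx_cov V i) *m H k i *m V k i.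

(* The trace before it is known to be real; it depends on the fixed precoder
   [Vhat] only through the fixed matrix [mmse Vhat i]. *)
Definition ltrace (Vhat : forall l : 'I_K, I l -> 'M[R[i]]_(M * Q l, d))
    (k : 'I_K) (i : I k) (V : 'M[R[i]]_(M * Q k, d)) (C : 'M[R[i]]_N) : R[i] :=
  \tr (invmx (mmse Vhat i) *m V^t* *m (H k i)^t* *m invmx C *m H k i *m V).

End Network.

(* Main.v *)
(* The trace form is a pointwise supremum of real-affine functions of the pair:
   with [X = H V], each matrix [Y] gives the lower bound
   [tr (W (Y^H X + X^H Y - Y^H C Y))] of [tr (W X^H C^-1 X)], because the
   difference is [tr (W D)] with [D = (X - C Y)^H C^-1 (X - C Y)] and [W], [D]
   are both positive semidefinite; equality holds at [Y = C^-1 X].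
   Positivity of the weight [W = E^-1] comes from the identity
   [E = E^H E + Y^H B Y], where [B] is the interference-plus-noise covariance
   and [Y] is the MMSE receiver. *)

Require Import Defs.
From HB Require Import structures.
From mathcomp Require Import all_boot all_order all_algebra.
From mathcomp Require Import sesquilinear spectral complex.
From mathcomp Require Import boolp classical_sets reals convex.
From mathcomp Require Import interval_inference.

Set Implicit Arguments.
Unset Strict Implicit.
Unset Printing Implicit Defensive.

Import Order.TTheory GRing.Theory Num.Theory.
Local Open Scope classical_set_scope.
Local Open Scope ring_scope.

Local Open Scope sesquilinear_scope.
Local Open Scope complex_scope.

(** * Positive semidefinite and positive definite Hermitian matrices *)

Section PositiveMatrices.
Variable R : rcfType.
Local Notation C := R[i].

Definition hermpsd n (A : 'M[C]_n) : Prop :=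
  A \is hermsymmx /\ forall x : 'cV[C]_n, 0 <= (x^t* *m A *m x) 0 0.

Lemma adjmxM m n p (A : 'M[C]_(m, n)) (B : 'M_(n, p)) :
  (A *m B)^t* = B^t* *m A^t*.
Proof. by rewrite trmx_mul map_mxM. Qed.

Lemma adjmxD m n (A B : 'M[C]_(m, n)) : (A + B)^t* = A^t* + B^t*.
Proof. by rewrite linearD map_mxD. Qed.

Lemma adjmxB m n (A B : 'M[C]_(m, n)) : (A - B)^t* = A^t* - B^t*.
Proof. by rewrite linearB map_mxB. Qed.

Lemma adjmx1 n : (1%:M : 'M[C]_n)^t* = 1%:M.
Proof. by rewrite trmx1 map_mx1. Qed.

Lemma adjmxZ m n (a : R) (A : 'M[C]_(m, n)) : (a%:C *: A)^t* = a%:C *: A^t*.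
Proof. by rewrite linearZ /= map_mxZ /= [Num.conj _]conjc_real. Qed.

Lemma adjmx_inv n (A : 'M[C]_n) : (invmx A)^t* = invmx (A^t*).
Proof. by rewrite trmx_inv map_invmx. Qed.

Lemma hermsymmxE n (A : 'M[C]_n) : (A \is hermsymmx) = (A^t* == A).
Proof. by rewrite qualifE /= expr0 scale1r eq_sym. Qed.

Lemma colvec_norm_ge0 n (x : 'cV[C]_n) : 0 <= (x^t* *m x) 0 0.
Proof.
rewrite mxE; apply: sumr_ge0 => j _.
by rewrite !mxE mulrC mul_conjC_ge0.
Qed.

Lemma colvec_norm_gt0 n (x : 'cV[C]_n) : x != 0 -> 0 < (x^t* *m x) 0 0.
Proof.
move=> x0; rewrite lt_def colvec_norm_ge0 andbT.
apply: contra x0; rewrite mxE psumr_eq0 => [/allP s0|j _]; last first.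
  by rewrite !mxE mulrC mul_conjC_ge0.
apply/eqP/colP => j; have := s0 j (mem_index_enum j).
by rewrite !mxE mulrC mul_conjC_eq0 => /eqP.
Qed.

Lemma hermpsdD n (A B : 'M[C]_n) : hermpsd A -> hermpsd B -> hermpsd (A + B).
Proof.
move=> [/[!hermsymmxE]/eqP aA pA] [/[!hermsymmxE]/eqP aB pB]; split.
  by rewrite hermsymmxE adjmxD aA aB.
by move=> x; rewrite mulmxDr mulmxDl mxE addr_ge0.
Qed.

Lemma hermpsd0 n : hermpsd (0 : 'M[C]_n).
Proof.
split=> [|x]; last by rewrite mulmx0 mul0mx mxE.
by rewrite hermsymmxE trmx0 map_mx0.
Qed.

Lemma hermpsd_congr m n (A : 'M[C]_m) (B : 'M_(m, n)) :
  hermpsd A -> hermpsd (B^t* *m A *m B).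
Proof.
move=> [/[!hermsymmxE]/eqP aA pA]; split=> [|x].
  by rewrite hermsymmxE !adjmxM aA trmxCK mulmxA.
suff -> : x^t* *m (B^t* *m A *m B) *m x = (B *m x)^t* *m A *m (B *m x).
  exact: pA.
by rewrite adjmxM !mulmxA.
Qed.

Lemma hermpsd1 n : hermpsd (1%:M : 'M[C]_n).
Proof.
split=> [|x]; first by rewrite hermsymmxE adjmx1.
by rewrite mulmx1 colvec_norm_ge0.
Qed.

Lemma hermpsd_gram m n (A : 'M[C]_(m, n)) : hermpsd (A *m A^t*).
Proof.
by have := hermpsd_congr (A^t*) (hermpsd1 n); rewrite trmxCK mulmx1.
Qed.

Lemma hermpsd_diag_ge0 n (A : 'M[C]_n) j : hermpsd A -> 0 <= A j j.
Proof.
move=> [_ /(_ (delta_mx j 0))].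
have -> : (delta_mx j 0 : 'cV[C]_n)^t* = delta_mx 0 j.
  by rewrite trmx_delta map_delta_mx.
by rewrite -rowE -colE !mxE.
Qed.

Lemma hermposdef_adj n (A : 'M[C]_n) : hermposdef A -> A^t* = A.
Proof. by case; rewrite hermsymmxE => /eqP. Qed.

Lemma hermposdef_hermpsd n (A : 'M[C]_n) : hermposdef A -> hermpsd A.
Proof.
move=> [aA pA]; split=> // x.
have [->|x0] := eqVneq x 0; first by rewrite mulmx0 mxE.
exact/ltW/pA.
Qed.

Lemma hermposdefD n (A B : 'M[C]_n) :
  hermpsd A -> hermposdef B -> hermposdef (A + B).
Proof.
move=> pA pB; have [aAB _] := hermpsdD pA (hermposdef_hermpsd pB).
split=> // x x0; rewrite mulmxDr mulmxDl mxE.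
by apply: ltr_wpDl; [exact: pA.2|exact: pB.2].
Qed.

Lemma hermpsdZ n (a : R) (A : 'M[C]_n) :
  0 <= a -> hermpsd A -> hermpsd (a%:C *: A).
Proof.
move=> a0 [/[!hermsymmxE]/eqP aA pA]; split=> [|x].
  by rewrite hermsymmxE adjmxZ aA.
by rewrite -scalemxAr -scalemxAl mxE mulr_ge0 ?ler0c.
Qed.

Lemma hermposdefZ n (a : R) (A : 'M[C]_n) :
  0 < a -> hermposdef A -> hermposdef (a%:C *: A).
Proof.
move=> a0 [/[!hermsymmxE]/eqP aA pA]; split=> [|x x0].
  by rewrite hermsymmxE adjmxZ aA.
by rewrite -scalemxAr -scalemxAl mxE mulr_gt0 ?pA ?ltcR.
Qed.

Lemma hermposdef_scalar n (a : R) : 0 < a -> hermposdef (a%:C%:M : 'M[C]_n).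
Proof.
move=> a0; rewrite -scalemx1; apply: hermposdefZ => //.
split=> [|x x0]; first by rewrite hermsymmxE adjmx1.
by rewrite mulmx1 colvec_norm_gt0.
Qed.

(** A nonzero kernel vector would make the quadratic form vanish. The transpose turns column kernel
    vectors into the row vectors that [kermx] handles. *)
Lemma posdef_unitmx n (A : 'M[C]_n) :
  (forall x : 'cV_n, x != 0 -> 0 < (x^t* *m A *m x) 0 0) -> A \in unitmx.
Proof.
move=> pA; rewrite -unitmx_tr -row_free_unit -kermx_eq0.
apply/rowV0P => v /sub_kermxP vA0; apply/eqP/negP => /negP v0.
have /pA : v^T != 0 by rewrite trmx_eq0.
by rewrite -mulmxA -[A]trmxK -trmx_mul vA0 trmx0 mulmx0 mxE ltxx.
Qed.

Lemma hermposdef_unitmx n (A : 'M[C]_n) : hermposdef A -> A \in unitmx.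
Proof. by case=> _ /posdef_unitmx. Qed.

Lemma hermposdef_invmx n (A : 'M[C]_n) : hermposdef A -> hermposdef (invmx A).
Proof.
move=> hA; have uA := hermposdef_unitmx hA; have aA := hermposdef_adj hA.
have aV : (invmx A)^t* = invmx A by rewrite adjmx_inv aA.
split=> [|x x0]; first by rewrite hermsymmxE aV.
have -> : x^t* *m invmx A *m x = (invmx A *m x)^t* *m A *m (invmx A *m x).
  by rewrite adjmxM aV -!mulmxA mulKVmx.
apply: hA.2; apply: contra x0 => /eqP Vx0.
by rewrite -[x](mulKVmx uA) Vx0 mulmx0.
Qed.

Lemma hermposdef_conv n (A B : 'M[C]_n) (a b : R) :
  0 <= a -> 0 <= b -> a + b = 1 -> hermposdef A -> hermposdef B ->
  hermposdef (a%:C *: A + b%:C *: B).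
Proof.
move=> a0 b0 ab1 hA hB; have pA := hermposdef_hermpsd hA.
(* Either weight may vanish: at [b = 0] the combination is [A] itself, otherwise the term in [B]
   alone supplies strict positivity. *)
have [b_eq0|b_neq0] := eqVneq b 0.
  move: ab1; rewrite b_eq0 addr0 => ->.
  by rewrite !rmorph1 !rmorph0 scale1r scale0r addr0.
apply: hermposdefD; first exact: hermpsdZ.
by apply: hermposdefZ; rewrite // lt_def b_neq0.
Qed.

(** Diagonalise [W] by a unitary [P]. By cyclicity the trace becomes the sum of the eigenvalues of
    [W] times the diagonal entries of [P A P^t*], and all of these are nonnegative. *)
Lemma hermposdef_trace_ge0 n (W A : 'M[C]_n) :
  hermposdef W -> hermpsd A -> 0 <= \tr (W *m A).
Proof.
move=> hW pA; have /orthomx_spectralP := hermitian_normalmx hW.1.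
set P := spectralmx W; set D := spectral_diag W => WE.
have uP : P \is unitarymx by exact: spectral_unitarymx.
have D_ge0 j : 0 <= D 0 j.
  (* The eigenvalues are the diagonal entries of [P W P^t*], a congruence of [W]. *)
  have /(@hermpsd_diag_ge0 _ _ j) := hermpsd_congr (P^t*) (hermposdef_hermpsd hW).
  rewrite trmxCK -invmx_unitary // WE !mulmxA mulmxV ?spectral_unit //.
  by rewrite mul1mx mulmxK ?spectral_unit // !mxE eqxx mulr1n.
rewrite WE -!mulmxA mxtrace_mulC -mulmxA invmx_unitary //.
rewrite /mxtrace; apply: sumr_ge0 => j _.
rewrite mul_diag_mx mxE mulr_ge0 //.
by rewrite -{1}[P]trmxCK -mulmxA mulmxA; apply/hermpsd_diag_ge0/hermpsd_congr.
Qed.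

End PositiveMatrices.

(** * Positive definiteness of the MMSE matrix *)

Section MmseMatrix.
Variable R : rcfType.
Local Notation C := R[i].

Lemma hermposdef_mmse_gram m n (B : 'M[C]_m) (G : 'M[C]_(m, n)) :
  hermposdef B ->
  hermposdef (1%:M - G^t* *m invmx (G *m G^t* + B) *m G).
Proof.
move=> hB; set J := G *m G^t* + B.
have hJ : hermposdef J by apply: hermposdefD hB; exact: hermpsd_gram.
have uJ := hermposdef_unitmx hJ.
have aV := hermposdef_adj (hermposdef_invmx hJ).
have BE : B = J - G *m G^t* by rewrite addrC addKr.
rewrite -mulmxA; set Y := invmx J *m G.
have JY : J *m Y = G by rewrite mulKVmx.
have YG : Y^t* *m G = G^t* *m Y by rewrite adjmxM aV mulmxA.
(* From here [J] and [Y] are opaque; the argument uses only the relations collected above. *)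
move: J Y => J Y in hJ uJ aV BE JY YG *.
have aE : (1%:M - G^t* *m Y)^t* = 1%:M - G^t* *m Y.
  by rewrite adjmxB adjmx1 adjmxM trmxCK YG.
(* With [E = 1 - G^t* Y] the right-hand side is [E (1 - E)]; adding [E^t* E = E E] leaves [E]. *)
have YBY : Y^t* *m B *m Y = (1%:M - G^t* *m Y) *m (G^t* *m Y).
  rewrite BE mulmxBr mulmxBl -[Y^t* *m J *m Y]mulmxA JY YG.
  by rewrite [in RHS]mulmxBl mul1mx !mulmxA YG.
have EE : 1%:M - G^t* *m Y =
    (1%:M - G^t* *m Y)^t* *m (1%:M - G^t* *m Y) + Y^t* *m B *m Y.
  by rewrite aE YBY -mulmxDr subrK mulmx1.
split=> [|x x0]; first by rewrite hermsymmxE aE.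
set E := 1%:M - _ in EE *.
have -> : x^t* *m E *m x =
    (E *m x)^t* *m (E *m x) + (Y *m x)^t* *m B *m (Y *m x).
  by rewrite {1}EE mulmxDr mulmxDl !adjmxM !mulmxA.
(* The two squares cannot vanish together: if [Y x = 0] then [E x = x], so the first is the squared
   norm of [x]; otherwise the second is positive because [B] is. *)
rewrite mxE; have [Yx0|Yx0] := eqVneq (Y *m x) 0.
  rewrite Yx0 mulmx0 [X in _ + X]mxE addr0; apply: colvec_norm_gt0.
  by rewrite mulmxBl mul1mx -mulmxA Yx0 mulmx0 subr0.
by apply: ltr_wpDl (colvec_norm_ge0 _) _; exact: hB.2.
Qed.

Lemma mmse_hermposdef (K M N d : nat) (Q : 'I_K -> nat) (I : 'I_K -> finType)
    (H : forall l k : 'I_K, I k -> 'M[C]_(N, M * Q l)) (sigma : R)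
    (V : forall l : 'I_K, I l -> 'M[C]_(M * Q l, d)) (k : 'I_K) (i : I k) :
  0 < sigma ^+ 2 -> hermposdef (mmse H sigma V i).
Proof.
move=> s0; set G := H k k i *m V k i.
suff [B hB rxE] : exists2 B, hermposdef B & rx_cov H sigma V i = G *m G^t* + B.
  have := hermposdef_mmse_gram G hB; rewrite -rxE /mmse /G adjmxM.
  by rewrite !mulmxA.
have termE l (j : I l) : H l k i *m V l j *m (V l j)^t* *m (H l k i)^t* =
    (H l k i *m V l j) *m (H l k i *m V l j)^t*.
  by rewrite adjmxM !mulmxA.
(* Splitting off the user's own signal as [G G^t*] leaves as [B] the intra-cell interference, the
   inter-cell interference and the noise; the noise makes [B] definite. *)
rewrite /rx_cov (bigD1 k) //= (bigD1 i) //= termE -!addrA.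
eexists; last reflexivity.
have sumP (J : finType) (P : pred J) (F : J -> 'M[C]_N) :
    (forall j, hermpsd (F j)) -> hermpsd (\sum_(j | P j) F j).
  by move=> pF; elim/big_ind: _ => //; [exact: hermpsd0|exact: hermpsdD].
apply: hermposdefD.
  by apply: (sumP) => j; rewrite termE; exact: hermpsd_gram.
apply: hermposdefD; last exact: hermposdef_scalar.
by apply: (sumP) => l; apply: sumP => j; rewrite termE; exact: hermpsd_gram.
Qed.

End MmseMatrix.

(** * Joint convexity of the weighted matrix fractional function *)

Section TraceForm.
Variables (R : rcfType) (n d : nat).
Local Notation C := R[i].
Implicit Types (W : 'M[C]_d) (A : 'M[C]_n) (X Y : 'M[C]_(n, d)).

Definition matrix_fractional W X A := \tr (W *m (X^t* *m invmx A *m X)).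

Definition affine_minorant W Y X A :=
  \tr (W *m (Y^t* *m X + X^t* *m Y - Y^t* *m A *m Y)).

Lemma matrix_fractional_ge0 W X A :
  hermposdef W -> hermposdef A -> 0 <= matrix_fractional W X A.
Proof.
move=> hW hA; apply: hermposdef_trace_ge0 => //.
exact/hermpsd_congr/hermposdef_hermpsd/hermposdef_invmx.
Qed.

(** Completing the square: the gap is the trace of [W] against a congruence of [invmx A]. *)
Lemma affine_minorant_le W Y X A : hermposdef W -> hermposdef A ->
  affine_minorant W Y X A <= matrix_fractional W X A.
Proof.
move=> hW hA; rewrite -subr_ge0 -linearB -mulmxBr.
have uA := hermposdef_unitmx hA.
have pV := hermposdef_hermpsd (hermposdef_invmx hA).
suff -> : X^t* *m invmx A *m X - (Y^t* *m X + X^t* *m Y - Y^t* *m A *m Y) =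
    (X - A *m Y)^t* *m invmx A *m (X - A *m Y).
  exact/hermposdef_trace_ge0/hermpsd_congr.
rewrite adjmxB adjmxM (hermposdef_adj hA) mulmxBr !mulmxBl -!mulmxA.
rewrite !mulKmx // mulKVmx //.
by rewrite -[X in _ - X = _]addrA opprD addrA.
Qed.

Lemma affine_minorant_touch W X A : hermposdef A ->
  affine_minorant W (invmx A *m X) X A = matrix_fractional W X A.
Proof.
move=> hA; congr (\tr (_ *m _)).
have aV := hermposdef_adj (hermposdef_invmx hA).
by rewrite adjmxM aV -!mulmxA mulKVmx ?hermposdef_unitmx // addrK.
Qed.

(** For fixed [Y] the minorant has no constant term and is real-linear in the pair. The scalars are
    real because [X] also enters through its conjugate transpose. *)
Lemma affine_minorant_conv W Y X1 X2 A1 A2 (a b : R) :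
  affine_minorant W Y (a%:C *: X1 + b%:C *: X2) (a%:C *: A1 + b%:C *: A2) =
  a%:C * affine_minorant W Y X1 A1 + b%:C * affine_minorant W Y X2 A2.
Proof.
rewrite -!mxtraceZ -mxtraceD !scalemxAr -mulmxDr; congr (\tr (_ *m _)).
rewrite adjmxD !adjmxZ !mulmxDr !mulmxDl -!scalemxAr -!scalemxAl.
rewrite opprD [X in X + _ = _]addrACA [LHS]addrACA.
by rewrite !scalerBr !scalerDr.
Qed.

Lemma matrix_fractional_convex W X1 X2 A1 A2 (a b : R) :
  hermposdef W -> hermposdef A1 -> hermposdef A2 ->
  0 <= a -> 0 <= b -> a + b = 1 ->
  matrix_fractional W (a%:C *: X1 + b%:C *: X2) (a%:C *: A1 + b%:C *: A2) <=
  a%:C * matrix_fractional W X1 A1 + b%:C * matrix_fractional W X2 A2.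
Proof.
move=> hW hA1 hA2 a0 b0 ab1.
(* [Y] is chosen to touch at the convex combination; the same [Y] then gives a lower bound at both
   endpoints. *)
rewrite -affine_minorant_touch; last exact: hermposdef_conv.
rewrite affine_minorant_conv.
by apply: lerD; apply: ler_wpM2l; rewrite ?ler0c ?affine_minorant_le.
Qed.

End TraceForm.

Lemma Re_conv (R : rcfType) (a b : R) (z w : R[i]) :
  complex.Re (a%:C * z + b%:C * w) = a * complex.Re z + b * complex.Re w.
Proof. by case: z w => [z1 z2] [w1 w2] /=; rewrite !mul0r !subr0. Qed.

(** The precoder enters only through [X = H V], which is linear in [V], so joint convexity in
    [(X, A)] carries over to [(V, A)]. *)
Lemma ltraceE (R : rcfType) (K M N d : nat) (Q : 'I_K -> nat)
    (I : 'I_K -> finType)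
    (H : forall l k : 'I_K, I k -> 'M[R[i]]_(N, M * Q l)) (sigma : R)
    (Vhat : forall l : 'I_K, I l -> 'M[R[i]]_(M * Q l, d)) (k : 'I_K) (i : I k)
    (V : 'M[R[i]]_(M * Q k, d)) (A : 'M[R[i]]_N) :
  ltrace H sigma Vhat i V A =
  matrix_fractional (invmx (mmse H sigma Vhat i)) (H k k i *m V) A.
Proof. by rewrite /ltrace /matrix_fractional adjmxM !mulmxA. Qed.

Local Close Scope complex_scope.
Local Close Scope sesquilinear_scope.

Theorem lemma1 (R : realType) (K M N d : nat)
  (Q : 'I_K -> nat) (I : 'I_K -> finType)
  (H : forall l k : 'I_K, I k -> 'M[R[i]]_(N, M * Q l))
  (sigma : R)
  (Vhat : forall l : 'I_K, I l -> 'M[R[i]]_(M * Q l, d))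
  (k : 'I_K) (i : I k)
  (M_gt0 : (0 < M)%N) (N_gt0 : (0 < N)%N) (d_gt0 : (0 < d)%N)
  (Q_gt0 : forall l : 'I_K, (0 < Q l)%N)
  (d_le : (d <= minn M N)%N)
  (sigma2_gt0 : 0 < sigma ^+ 2) :
  let E := (realified 'M[R[i]]_(M * Q k, d) * realified 'M[R[i]]_N)%type in
  let region : set (convex_lmodType E) := [set p | hermposdef p.2] in
  (forall p : E, region p -> ltrace H sigma Vhat i p.1 p.2 \is Num.real) /\
  convex_set region /\
  convex_function region
    (fun p : convex_lmodType E =>
       complex.Re (ltrace H sigma Vhat i p.1 p.2)).
Proof.
move=> E region.
have hW := hermposdef_invmx (mmse_hermposdef H Vhat i sigma2_gt0).
have onemD (t : {i01 R}) : t%:num + (1 - t%:num) = 1 by rewrite addrC subrK.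
have num_ge0 (t : {i01 R}) : 0 <= t%:num by exact: ge0.
have onem_ge0 (t : {i01 R}) : 0 <= 1 - t%:num by rewrite subr_ge0 le1.
split; [|split].
- move=> p hp; rewrite ltraceE; apply: ger0_real.
  exact: matrix_fractional_ge0.
- move=> x y t /set_mem hx /set_mem hy; apply/mem_set.
  exact: (hermposdef_conv (num_ge0 t) (onem_ge0 t) (onemD t) hx hy).
- move=> t x y /set_mem hx /set_mem hy.
  have := @matrix_fractional_convex _ _ _ _ (H k k i *m x.1) (H k k i *m y.1)
    _ _ _ _ hW hx hy (num_ge0 t) (onem_ge0 t) (onemD t).
  rewrite !scalemxAr -mulmxDr -!ltraceE.
  (* The order of [R[i]] combines equality of imaginary parts with an inequality of real parts; the
     latter is the goal once convex combinations in [E] are unfolded componentwise. *)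
  by rewrite lecE Re_conv => /andP[_ le_f]; exact: le_f.
Qed.
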